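(* Let $\mathcal{A}$ be a Banach algebra such that every cyclic derivation $D:\mathcal{A}\to\mathcal{A}^{*}$ is weakly compact. If the topological center $Z(\mathcal{A}^{**})$ is approximately cyclic amenable, then so is $\mathcal{A}$.
   Context: Banach algebras are over $\mathbb{C}$ and need not be unital. For a Banach algebra $\mathcal{A}$, the dual $\mathcal{A}^{*}$ is a Banach $\mathcal{A}$-bimodule via $\langle a\cdot x^{*},x\rangle=\langle x^{*},xa\rangle$ and $\langle x^{*}\cdot a,x\rangle=\langle x^{*},ax\rangle$ for $a,x\in\mathcal{A}$, $x^*\in\mathcal{A}^*$. A derivation $D:\mathcal{A}\to\mathcal{A}^{*}$ is a bounded linear map with $D(ab)=D(a)\cdot b+a\cdot D(b)$ for all $a,b\in\mathcal{A}$. It is cyclic if $\langle D(a),b\rangle+\langle D(b),a\rangle=0$ for all $a,b\in\mathcal{A}$. It is approximately inner if there is a net $(x_\alpha)\subseteq\mathcal{A}^{*}$ (not required to be bounded) with $D(a)=\lim_\alpha(a\cdot x_\alpha-x_\alpha\cdot a)$ in norm for every $a\in\mathcal{A}$. $\mathcal{A}$ is approximately cyclic amenable if every cyclic derivation $D:\mathcal{A}\to\mathcal{A}^{*}$ is approximately inner. The first Arens product $\square$ on $\mathcal{A}^{**}$ is defined by $\langle a^{*}\cdot a,b\rangle=\langle a^{*},ab\rangle$, $\langle a^{**}\cdot a^{*},a\rangle=\langle a^{**},a^{*}\cdot a\rangle$, $\langle a^{**}\square b^{**},a^{*}\rangle=\langle a^{**},b^{**}\cdot a^{*}\rangle$ for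 $a,b\in\mathcal{A}$, $a^*\in\mathcal{A}^*$, $a^{**},b^{**}\in\mathcal{A}^{**}$. The topological center of $\mathcal{A}^{**}$ is $Z(\mathcal{A}^{**})=\{b^{**}\in\mathcal{A}^{**}: \text{the map } a^{**}\mapsto b^{**}\square a^{**} \text{ is } \omega^{*}\text{-}\omega^{*}\text{-continuous on } \mathcal{A}^{**}\}$, where $\omega^*$ denotes the weak-$*$ topology; it is a Banach algebra as a closed subalgebra of $(\mathcal{A}^{**},\square)$. *)

(* Defs.v *)
From HB Require Import structures.
From mathcomp Require Import all_boot all_order all_algebra.
From mathcomp Require Import all_classical all_reals all_analysis.
From mathcomp Require Import complex ring.

Set Implicit Arguments.
Unset Strict Implicit.
Unset Printing Implicit Defensive.

Import Order.TTheory GRing.Theory Num.Theory.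
Import numFieldNormedType.Exports.

Local Open Scope classical_set_scope.
Local Open Scope ring_scope.
Local Open Scope complex_scope.

(* Banach algebras need not be unital, hence the product is not the one of a
   MathComp ring. The norm of a normedModType R[i] takes its values in R[i]. *)
HB.mixin Record isBanachAlgebra (K : numFieldType) A
    & CompleteNormedModule K A := {
  amul : A -> A -> A ;
  amulA : associative amul ;
  amulPl : forall (k : K) (x y z : A),
    amul (k *: x + y) z = k *: amul x z + amul y z ;
  amulPr : forall (k : K) (x y z : A),
    amul x (k *: y + z) = k *: amul x y + amul x z ;
  ler_normMa : forall x y : A, `|amul x y| <= `|x| * `|y|
}.

#[short(type="banachAlgType")]
HB.structure Definition BanachAlgebra (K : numFieldType) :=
  {A of CompleteNormedModule K A & isBanachAlgebra K A}.

Section complex_complete.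
Variable R : realType.
Implicit Types (z : R[i]) (r : R).

Lemma normRe z : (complex.Re `|z|)%:C = `|z|.
Proof. by rewrite RRe_real ?normr_real. Qed.

Lemma ge0RRe z : 0 <= z -> (complex.Re z)%:C = z.
Proof. by move=> z0; rewrite RRe_real ?ger0_real. Qed.

Lemma normRe_le z : `|complex.Re z|%:C <= `|z|.
Proof.
rewrite normc_def lecR -sqrtr_sqr ler_wsqrtr// lerDl sqr_ge0//.
Qed.

Lemma normIm_le z : `|complex.Im z|%:C <= `|z|.
Proof.
rewrite normc_def lecR -sqrtr_sqr ler_wsqrtr// lerDr sqr_ge0//.
Qed.

Lemma norm_leReIm z : `|z| <= `|complex.Re z|%:C + `|complex.Im z|%:C.
Proof.
rewrite {1}(complexE z) (le_trans (ler_normD _ _))// normrM.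
rewrite !normc_def /= !expr0n/= !addr0 expr1n add0r sqrtr1 mul1r.
by rewrite !sqrtr_sqr.
Qed.

Lemma complex_cauchy_cvg (F : set_system R[i]^o) :
  ProperFilter F -> cauchy F -> cvg F.
Proof.
move=> FF /cauchyP Fc.
have h (p : R[i] -> R) : (forall z w, `|p z - p w|%:C <= `|z - w|) ->
    exists l : R, (p : R[i]^o -> R) @ F --> l.
  move=> pL; have : cvg ((p : R[i]^o -> R) @ F).
    apply: cauchy_cvg; apply/cauchyP => e e0.
    have e0' : 0 < e%:C by rewrite ltcR.
    have [z Fz] := Fc _ e0'; exists (p z).
    change (F [set w | ball (p z) e (p w)]); apply: filterS Fz => w.
    rewrite -!ball_normE/= => zw.
    by rewrite -ltcR (le_lt_trans (pL _ _)).
  by move=> /cvg_ex.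
have [a aP] : exists l : R, (@complex.Re R : R[i]^o -> R) @ F --> l.
  by apply: h => z w; rewrite -raddfB; exact: normRe_le.
have [b bP] : exists l : R, (@complex.Im R : R[i]^o -> R) @ F --> l.
  by apply: h => z w; rewrite -raddfB; exact: normIm_le.
apply/cvg_ex; exists (a +i* b : R[i]^o).
apply/cvgrPdist_lt => e e0.
have eE : e = (complex.Re e)%:C by rewrite ge0RRe ?ltW.
have e0' : 0 < complex.Re e by move: e0; rewrite {1}eE ltcR.
have e2 : 0 < complex.Re e / 2 by rewrite divr_gt0.
have /cvgrPdist_lt/(_ _ e2) A := aP; have /cvgrPdist_lt/(_ _ e2) B := bP.
near=> z.
have az : `|a - complex.Re z| < complex.Re e / 2 by near: z.
have bz : `|b - complex.Im z| < complex.Re e / 2 by near: z.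
apply: le_lt_trans (norm_leReIm _) _.
rewrite !raddfB/= -rmorphD/= eE ltcR [ltRHS](splitr (complex.Re e)).
by rewrite ltrD.
Unshelve. all: by end_near. Qed.

End complex_complete.

(* The topological dual: continuous linear functionals, as a subspace of the
   space of all functions. *)
Section dual.
Variables (R : realType) (E : normedModType R[i]).

Definition dual_pred : {pred E -> R[i]^o} :=
  fun f => `[< linear f /\ continuous f >].

Record dual := Dual { dual_fun :> E -> R[i]^o ; _ : dual_fun \in dual_pred }.

HB.instance Definition _ := [isSub for dual_fun].
HB.instance Definition _ := [Choice of dual by <:].

Lemma dual_pred_submod : submod_closed dual_pred.
Proof.
split.
  apply/asboolP; split; first by move=> k x y /=; rewrite scaler0 addr0.
  exact: cst_continuous.
move=> k f g /asboolP[fl fc] /asboolP[gl gc]; apply/asboolP; split.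
  move=> a x y; rewrite !fctE/= fl gl !scalerDr !scalerA (mulrC k a).
  by rewrite addrACA.
move=> x; apply: (@continuousD _ _ _ (k \*: f) g); last exact: gc.
by apply: continuousZr; exact: fc.
Qed.

HB.instance Definition _ :=
  GRing.isSubmodClosed.Build R[i] (E -> R[i]^o) dual_pred dual_pred_submod.
HB.instance Definition _ := [SubChoice_isSubLmodule of dual by <:].

End dual.

Arguments dual_pred {R} E.

Section dual_norm.
Variables (R : realType) (E : normedModType R[i]).
Implicit Types (f g : dual E) (x y : E).

Lemma dual_linear f : linear f.
Proof. by case: f => f /= /asboolP[]. Qed.

Lemma dual_continuous f : continuous f.
Proof. by case: f => f /= /asboolP[]. Qed.

HB.instance Definition _ f :=
  GRing.isLinear.Build R[i] E R[i]^o *:%R f (@dual_linear f).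

Lemma dualP f g : (forall x, f x = g x) -> f = g.
Proof. by move=> fg; apply/val_inj/funext. Qed.

Lemma dualD f g x : (f + g) x = f x + g x. Proof. by []. Qed.
Lemma dualB f g x : (f - g) x = f x - g x. Proof. by []. Qed.
Lemma dualZ k f x : (k *: f) x = k * f x. Proof. by []. Qed.
Lemma dual0 x : (0 : dual E) x = 0. Proof. by []. Qed.

Definition unit_ball : set E := [set x | `|x| <= 1].

Definition opnorm f : R :=
  sup [set complex.Re `|f x| | x in unit_ball].

Lemma bounded_dual (f : E -> R[i]^o) (M : R[i]) : linear f ->
  (forall x, `|f x| <= M * `|x|) -> f \in dual_pred E.
Proof.
move=> fl fM; apply/asboolP; split=> //.
pose F : {linear E -> R[i]^o} :=
  HB.pack f (GRing.isLinear.Build _ _ _ _ f fl).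
apply: (@bounded_linear_continuous _ _ _ F).
apply/bounded_funP => r; exists (`|M| * `|r|) => x xr.
have r0 : 0 <= r by apply: le_trans xr.
apply: le_trans (fM x) _.
have [->|x0] := eqVneq x 0; first by rewrite normr0 mulr0 mulr_ge0.
have M0 : 0 <= M.
  by have := fM x; move/(le_trans (normr_ge0 _)); rewrite pmulr_lge0// normr_gt0.
by rewrite !ger0_norm// ler_wpM2l.
Qed.

Lemma dual_bounded f : exists2 M : R,
  0 <= M & forall x, `|f x| <= M%:C * `|x|.
Proof.
have /linear_boundedP/pinfty_ex_gt0[M M0 fM] : bounded_near f (nbhs (0 : E)).
  by apply/linear_bounded_continuous; exact: dual_continuous.
have M0' := ltW M0; exists (complex.Re M); last by rewrite ge0RRe.
by rewrite -ler0c ge0RRe.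
Qed.

Lemma opnorm_has_sup f : has_sup [set complex.Re `|f x| | x in unit_ball].
Proof.
split; first by exists (complex.Re `|f 0|), 0 => //; rewrite /unit_ball/= normr0.
have [M M0 fM] := dual_bounded f; exists M => _ [x x1 <-].
rewrite -lecR normRe; apply: le_trans (fM x) _.
by rewrite -[leRHS]mulr1 ler_wpM2l// ler0c.
Qed.

Lemma opnorm_ge0 f : 0 <= opnorm f.
Proof.
apply: (@le_trans _ _ (complex.Re `|f 0|)).
  by rewrite -ler0c normRe.
apply: sup_upper_bound; first exact: opnorm_has_sup.
by exists 0 => //; rewrite /unit_ball/= normr0.
Qed.

Lemma opnorm_ub f x : `|f x| <= (opnorm f)%:C * `|x|.
Proof.
have [->|x0] := eqVneq x 0; first by rewrite linear0 !normr0 mulr0.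
have nx : 0 < `|x| by rewrite normr_gt0.
rewrite -ler_pdivrMr//.
have -> : `|f x| / `|x| = `|f (`|x|^-1 *: x)|.
  by rewrite linearZ/= normrZ ger0_norm ?invr_ge0// mulrC.
rewrite -normRe lecR; apply: sup_upper_bound; first exact: opnorm_has_sup.
exists (`|x|^-1 *: x) => //.
by rewrite /unit_ball/= normrZ ger0_norm ?invr_ge0// mulVf// gt_eqF.
Qed.

Lemma opnorm_le f (M : R) :
  0 <= M -> (forall x, `|f x| <= M%:C * `|x|) -> opnorm f <= M.
Proof.
move=> M0 fM; apply: ge_sup; first by have [] := opnorm_has_sup f.
move=> _ [x x1 <-]; rewrite -lecR normRe; apply: le_trans (fM x) _.
by rewrite -[leRHS]mulr1 ler_wpM2l// ler0c.
Qed.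

Lemma opnormD f g : (opnorm (f + g))%:C <= (opnorm f)%:C + (opnorm g)%:C.
Proof.
rewrite -rmorphD/= lecR; apply: opnorm_le; first by rewrite addr_ge0 ?opnorm_ge0.
move=> x; rewrite dualD (le_trans (ler_normD _ _))// rmorphD/= mulrDl.
by rewrite lerD// opnorm_ub.
Qed.

Lemma opnormZ (k : R[i]) f : (opnorm (k *: f))%:C = `|k| * (opnorm f)%:C.
Proof.
have le (c : R[i]) h : (opnorm (c *: h))%:C <= `|c| * (opnorm h)%:C.
  rewrite -[`|c|]normRe -rmorphM/= lecR; apply: opnorm_le => [|x].
    by rewrite mulr_ge0 ?opnorm_ge0// -ler0c normRe.
  rewrite dualZ normrM rmorphM/= normRe -mulrA ler_wpM2l//.
  exact: opnorm_ub.
apply/eqP; rewrite eq_le le/=.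
have [->|k0] := eqVneq k 0; first by rewrite normr0 mul0r ler0c opnorm_ge0.
have nk : 0 < `|k| by rewrite normr_gt0.
rewrite mulrC -ler_pdivlMr// mulrC -normfV.
by rewrite -{1}(scale1r f) -(mulVf k0) -scalerA le.
Qed.

Lemma opnorm_eq0 f : (opnorm f)%:C = 0 -> f = 0.
Proof.
move=> f0; apply: dualP => x; apply/eqP; rewrite dual0 -normr_le0.
by rewrite (le_trans (opnorm_ub f x))// f0 mul0r.
Qed.

HB.instance Definition _ := @Lmodule_isNormed.Build R[i] (dual E)
  (fun f => (opnorm f)%:C) opnormD opnormZ opnorm_eq0.

Lemma dual_normE f : `|f| = (opnorm f)%:C. Proof. by []. Qed.

Lemma dual_norm_ub f x : `|f x| <= `|f| * `|x|.
Proof. exact: opnorm_ub. Qed.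

Lemma dual_norm_le f (M : R[i]) :
  0 <= M -> (forall x, `|f x| <= M * `|x|) -> `|f| <= M.
Proof.
move=> M0 fM; rewrite dual_normE -(ge0RRe M0) lecR; apply: opnorm_le.
  by rewrite -ler0c ge0RRe.
by move=> x; rewrite ge0RRe.
Qed.

Lemma dual_cauchy_cvg (F : set_system (dual E)) :
  ProperFilter F -> cauchy F -> cvg F.
Proof.
move=> FF /cauchyP Fc.
have Fe (e : R[i]) : 0 < e -> exists h : dual E, F [set f | `|h - f| < e].
  move=> e0; have [h Fh] := Fc _ e0; exists h.
  by apply: filterS Fh => f; rewrite -ball_normE.
have ev (x : E) : cvg ((fun f : dual E => f x) @ F : set_system R[i]^o).
  apply: complex_cauchy_cvg; apply/cauchyP => e e0.
  have d0 : 0 < e / (1 + `|x|).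
    by rewrite divr_gt0// (lt_le_trans ltr01)// lerDl.
  have [h Fh] := Fe _ d0; exists (h x).
  change (F [set f | ball (h x : R[i]^o) e (f x)]).
  apply: filterS Fh => f /= hf; rewrite -ball_normE/= -dualB.
  apply: le_lt_trans (dual_norm_ub _ _) _.
  have x1 : 0 < 1 + `|x| by rewrite (lt_le_trans ltr01)// lerDl.
  rewrite -(divfK (lt0r_neq0 x1) e).
  apply: (@le_lt_trans _ _ (`|h - f| * (1 + `|x|))).
    by rewrite ler_wpM2l// lerDr.
  by rewrite ltr_pM2r.
pose g (x : E) : R[i]^o := lim ((fun f : dual E => f x) @ F : set_system R[i]^o).
have gP x : (fun f : dual E => f x : R[i]^o) @ F --> g x by exact: ev.
have gh (h : dual E) e : F [set f | `|h - f| < e] ->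
    forall x, `|g x - h x| <= e * `|x|.
  move=> Fh x.
  apply/ler_addgt0Pr => d d0.
  have /cvgrPdist_lt/(_ _ d0) gd := gP x.
  have [f [/= hf fd]] := filter_ex (filterI Fh gd).
  rewrite [leRHS]addrC (le_trans (ler_distD (f x) _ _))// lerD//; first exact: ltW.
  rewrite distrC -dualB (le_trans (dual_norm_ub _ _))// ler_wpM2r//.
  exact: ltW.
have gl : linear g.
  move=> k x y.
  apply: (@cvg_unique R[i]^o (@norm_hausdorff _ _) _ (fmap_proper_filter _ FF)
    _ _ (gP (k *: x + y))).
  rewrite /mkset (_ : (fun f : dual E => f (k *: x + y)) =
    (fun f : dual E => k *: (f x : R[i]^o) + f y)); last first.
    by apply/funext => f; rewrite linearP.
  by apply: cvgD (gP y); apply: cvgZr; exact: gP.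
have [h1 Fh1] := Fe 1 ltr01.
have gd : g \in dual_pred E.
  apply: (@bounded_dual _ (1 + `|h1|)) => // x.
  rewrite -(subrK (h1 x) (g x)) mulrDl (le_trans (ler_normD _ _))// lerD//.
    exact: gh.
  exact: dual_norm_ub.
apply/cvg_ex; exists (Dual gd); apply/cvgrPdist_lt => e e0.
have e2 : 0 < e / 2 by rewrite divr_gt0.
have [h Fh] := Fe _ e2; near=> f.
rewrite (splitr e) (le_lt_trans (ler_distD h _ _))// ler_ltD//; last first.
  by near: f.
apply: dual_norm_le; first exact: ltW.
exact: gh.
Unshelve. all: by end_near. Qed.

HB.instance Definition _ :=
  Uniform_isComplete.Build (dual E) dual_cauchy_cvg.

End dual_norm.

Arguments unit_ball {R} E.

Section weak_topologies.
Variables (R : realType) (E : normedModType R[i]).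

Definition weak_star_space : Type :=
  initial_topology (fun f : dual E => (f : {ptws E -> R[i]^o})).
HB.instance Definition _ := Topological.copy weak_star_space
  (initial_topology (fun f : dual E => (f : {ptws E -> R[i]^o}))).

Definition weak_space : Type :=
  initial_topology (fun x : E =>
    (fun f : dual E => f x) : {ptws dual E -> R[i]^o}).
HB.instance Definition _ := Topological.copy weak_space
  (initial_topology (fun x : E =>
    (fun f : dual E => f x) : {ptws dual E -> R[i]^o})).

End weak_topologies.

Arguments weak_star_space {R} E.
Arguments weak_space {R} E.

Section weak_star_continuity.
Variables (R : realType) (E : normedModType R[i]).

Lemma weak_star_cvgP (F : set_system (weak_star_space E)) (f : dual E) : Filter F ->
  F --> (f : weak_star_space E) <-> forall x, (fun g : dual E => g x) @ F --> f x.
Proof.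
move=> FF; split=> [Ff x|Fx].
  apply: (@cvg_comp _ _ _ (fun g : weak_star_space E => (g : {ptws E -> R[i]^o}))
    (fun g : {ptws E -> R[i]^o} => g x)).
    apply: (@cvg_comp _ _ _ idfun) Ff _.
    exact: (@initial_continuous _ _
     (fun f : dual E => (f : {ptws E -> R[i]^o}))).
  exact: (@proj_continuous _ (fun=> R[i]^o) x).
move=> A; rewrite nbhsE => -[_ [[B Bo <-] Bf] BA].
apply: (filterS BA).
have H := proj2 (@pointwise_cvgP E R[i]^o
  ((fun g : dual E => (g : E -> R[i]^o)) @ F) f _) Fx.
by apply: H; exact: open_nbhs_nbhs.
Qed.

Lemma weak_star_continuousP (T : topologicalType) (phi : T -> weak_star_space E) :
  continuous phi <->
  forall x, continuous (fun t => (phi t : dual E) x : R[i]^o).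
Proof.
split=> [phic x t|phic t].
  exact: (proj1 (weak_star_cvgP _ (fmap_filter _ (nbhs_filter t))) (phic t) x).
by apply/weak_star_cvgP => x; exact: phic.
Qed.

Lemma weak_star_eval_continuous (x : E) :
  continuous ((fun f : dual E => f x : R[i]^o) : weak_star_space E -> R[i]^o).
Proof.
have idc : continuous (fun f : weak_star_space E => f) by move=> f; exact: cvg_id.
exact: (proj1 (weak_star_continuousP _) idc x).
Qed.

Lemma ker_eval_span (V : lmodType R[i]) (T : lmodType R[i])
    (ev : V -> T -> R[i]) :
  (forall v, scalar (ev v)) -> (forall t, scalar (ev^~ t)) ->
  forall (s : seq T) (phi : V -> R[i]), scalar phi ->
  (forall v, (forall t, t \in s -> ev v t = 0) -> phi v = 0) ->
  exists t, forall v, phi v = ev v t.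
Proof.
move=> evr evl; elim=> [|t s IH] phi phil phis.
  exists 0 => v; rewrite phis//.
  have /esym := evr v (-1) 0 0.
  by rewrite scaler0 addr0 mulN1r addNr.
have [[w [ws wt]]|nw] :=
    pselect (exists w, (forall u, u \in s -> ev w u = 0) /\ ev w t != 0).
  pose psi v := phi v - phi w / ev w t * ev v t.
  have [|v vs|u uP] := IH psi.
  - by move=> k x y; rewrite /psi phil evl; ring.
  - rewrite /psi; have := phil (- (ev v t / ev w t)) w v.
    rewrite phis => [H|u].
      by rewrite H; field.
    rewrite inE => /orP[/eqP->|us]; rewrite evl/=.
      by field.
    by rewrite (ws u)// (vs u)// mulr0 addr0.
  - exists (phi w / ev w t *: t + u) => v.
    by rewrite evr -uP /psi addrC subrK.
have [//|v vs|u uP] := IH phi; last by exists u.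
apply: phis => u; rewrite inE => /orP[/eqP->|]; last exact: vs.
by apply: contrapT => /eqP vt; apply: nw; exists v.
Qed.

Lemma weak_star_continuous_eval (phi : dual E -> R[i]^o) : linear phi ->
  continuous (phi : weak_star_space E -> R[i]^o) -> exists x, forall f, phi f = f x.
Proof.
move=> phil phic.
pose B (s : seq E) : set (weak_star_space E) :=
  [set f : dual E | forall x, x \in s -> `|f x| < 1].
pose F := filter_from setT B.
have FF : Filter F.
  apply: filter_from_filter; first by exists [::].
  move=> s t _ _; exists (s ++ t) => // f fst; split=> x xs; apply: fst.
    by rewrite mem_cat xs.
  by rewrite mem_cat xs orbT.
have F0 : F --> (0 : weak_star_space E).
  apply/weak_star_cvgP => x; apply/cvgrPdist_lt => e e0.
  exists [:: e^-1 *: x] => // f /(_ _ (mem_head _ _)) fx /=.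
  change (`|0 - f x| < e); rewrite sub0r normrN; move: fx.
  rewrite linearZ/= normrM normfV (gtr0_norm e0).
  by rewrite mulrC ltr_pdivrMr// mul1r.
have phi0 : phi 0 = 0 by have := phil (-1) 0 0; rewrite scaleN1r addNr scaleN1r addNr.
have /cvgrPdist_lt/(_ _ ltr01)[s _ sP] : phi @ F --> (0 : R[i]^o).
  by rewrite -phi0; apply: cvg_comp F0 _; exact: phic.
apply: (@ker_eval_span (dual E) E (fun f x => f x) _ _ s phi) => //.
- by move=> f k x y; rewrite linearP.
- move=> f fs; apply/eqP; rewrite -normr_eq0; apply/negP => /negP n0.
  have /sP : B s ((`|phi f|)^-1 *: f).
    by move=> x /fs fx; rewrite dualZ fx mulr0 normr0.
  have -> : phi (`|phi f|^-1 *: f) = `|phi f|^-1 * phi f.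
    by have := phil (`|phi f|^-1) f 0; rewrite phi0 !addr0.
  by rewrite /= sub0r normrN normrM normfV normr_id mulVf// ltxx.
Qed.

End weak_star_continuity.

Section algebra_theory.
Variables (K : numFieldType) (A : banachAlgType K).
Implicit Types x y z : A.

Lemma amulDl x y z : amul (x + y) z = amul x z + amul y z.
Proof. by rewrite -[x]scale1r amulPl !scale1r. Qed.

Lemma amulDr x y z : amul x (y + z) = amul x y + amul x z.
Proof. by rewrite -[y]scale1r amulPr !scale1r. Qed.

End algebra_theory.

Section arens.
Variables (R : realType) (A : banachAlgType R[i]).
Implicit Types (a b : A) (f : dual A) (F G : dual (dual A)).

Lemma dual_ract_subproof f a :
  (fun x : A => f (amul a x) : R[i]^o) \in dual_pred A.
Proof.
apply: (@bounded_dual _ _ _ (`|f| * `|a|)) => [k x y|x].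
  by rewrite amulPr linearP.
rewrite (le_trans (dual_norm_ub _ _))// -mulrA ler_wpM2l//.
exact: ler_normMa.
Qed.

(* <f . a, x> = <f, a x> *)
Definition dual_ract f a : dual A := Dual (dual_ract_subproof f a).

Lemma dual_lact_subproof a f :
  (fun x : A => f (amul x a) : R[i]^o) \in dual_pred A.
Proof.
apply: (@bounded_dual _ _ _ (`|f| * `|a|)) => [k x y|x].
  by rewrite amulPl linearP.
rewrite (le_trans (dual_norm_ub _ _))// -mulrA ler_wpM2l// mulrC.
exact: ler_normMa.
Qed.

(* <a . f, x> = <f, x a> *)
Definition dual_lact a f : dual A := Dual (dual_lact_subproof a f).

Lemma norm_dual_ract f a : `|dual_ract f a| <= `|f| * `|a|.
Proof.
apply: dual_norm_le => [|x /=]; first by rewrite mulr_ge0.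
rewrite (le_trans (dual_norm_ub _ _))// -mulrA ler_wpM2l//.
exact: ler_normMa.
Qed.

Lemma norm_dual_lact f a : `|dual_lact a f| <= `|f| * `|a|.
Proof.
apply: dual_norm_le => [|x /=]; first by rewrite mulr_ge0.
rewrite (le_trans (dual_norm_ub _ _))// -mulrA ler_wpM2l// mulrC.
exact: ler_normMa.
Qed.

Lemma dual_ractPl k f g a :
  dual_ract (k *: f + g) a = k *: dual_ract f a + dual_ract g a.
Proof. exact: dualP. Qed.

Lemma dual_ractPr k f a b :
  dual_ract f (k *: a + b) = k *: dual_ract f a + dual_ract f b.
Proof. by apply: dualP => x /=; rewrite amulPl linearP. Qed.

Lemma dual_lactPr k f g a :
  dual_lact a (k *: f + g) = k *: dual_lact a f + dual_lact a g.
Proof. exact: dualP. Qed.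

Lemma dual_lactPl k f a b :
  dual_lact (k *: a + b) f = k *: dual_lact a f + dual_lact b f.
Proof. by apply: dualP => x /=; rewrite amulPr linearP. Qed.

Lemma bidual_act_subproof F f :
  (fun a : A => F (dual_ract f a) : R[i]^o) \in dual_pred A.
Proof.
apply: (@bounded_dual _ _ _ (`|F| * `|f|)) => [k x y|x].
  by rewrite dual_ractPr linearP.
rewrite (le_trans (dual_norm_ub _ _))// -mulrA ler_wpM2l//.
exact: norm_dual_ract.
Qed.

(* <F . f, a> = <F, f . a> *)
Definition bidual_act F f : dual A := Dual (bidual_act_subproof F f).

Lemma norm_bidual_act F f : `|bidual_act F f| <= `|F| * `|f|.
Proof.
apply: dual_norm_le => [|x /=]; first by rewrite mulr_ge0.
rewrite (le_trans (dual_norm_ub _ _))// -mulrA ler_wpM2l//.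
exact: norm_dual_ract.
Qed.

Lemma bidual_actPr k F f g :
  bidual_act F (k *: f + g) = k *: bidual_act F f + bidual_act F g.
Proof. by apply: dualP => x /=; rewrite dual_ractPl linearP. Qed.

Lemma bidual_actPl k F G f :
  bidual_act (k *: F + G) f = k *: bidual_act F f + bidual_act G f.
Proof. exact: dualP. Qed.

Lemma arens_subproof F G :
  (fun f : dual A => F (bidual_act G f) : R[i]^o) \in dual_pred (dual A).
Proof.
apply: (@bounded_dual _ _ _ (`|F| * `|G|)) => [k x y|x].
  by rewrite bidual_actPr linearP.
rewrite (le_trans (dual_norm_ub _ _))// -mulrA ler_wpM2l//.
exact: norm_bidual_act.
Qed.

(* The first Arens product: <F [] G, f> = <F, G . f> *)
Definition arens F G : dual (dual A) := Dual (arens_subproof F G).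

Lemma norm_arens F G : `|arens F G| <= `|F| * `|G|.
Proof.
apply: dual_norm_le => [|x /=]; first by rewrite mulr_ge0.
rewrite (le_trans (dual_norm_ub _ _))// -mulrA ler_wpM2l//.
exact: norm_bidual_act.
Qed.

Lemma arensPl k (F G H : dual (dual A)) :
  arens (k *: F + G) H = k *: arens F H + arens G H.
Proof. exact: dualP. Qed.

Lemma arensPr k (F G H : dual (dual A)) :
  arens F (k *: G + H) = k *: arens F G + arens F H.
Proof. by apply: dualP => f /=; rewrite bidual_actPl linearP. Qed.

Lemma arensA : associative arens.
Proof.
move=> F G H; apply: dualP => f /=; congr (F _); apply: dualP => a /=.
congr (G _); apply: dualP => b /=; congr (H _); apply: dualP => c /=.
by rewrite amulA.
Qed.

Definition center_pred : {pred dual (dual A)} := fun F =>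
  `[< continuous
        (arens F : weak_star_space (dual A) -> weak_star_space (dual A)) >].

Lemma eval_subproof a : (fun f : dual A => f a : R[i]^o) \in dual_pred (dual A).
Proof.
apply: (@bounded_dual _ _ _ `|a|) => // f.
by rewrite mulrC; exact: dual_norm_ub.
Qed.

Lemma bidual_lact_subproof F f :
  (fun a : A => F (dual_lact a f) : R[i]^o) \in dual_pred A.
Proof.
apply: (@bounded_dual _ _ _ (`|F| * `|f|)) => [k x y|x].
  by rewrite dual_lactPl linearP.
rewrite (le_trans (dual_norm_ub _ _))// -mulrA ler_wpM2l//.
exact: norm_dual_lact.
Qed.

Let ract F f : dual A := Dual (bidual_lact_subproof F f).

(* F is in the topological center iff its first and second Arens products with
   every G agree; used below to show that the center is closed. *)
Lemma center_predP F :
  reflect (forall f G, arens F G f = G (Dual (bidual_lact_subproof F f)))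
          (F \in center_pred).
Proof.
apply: (iffP idP) => [/asboolP Fc f G|FP].
  have [||h hP] :=
    @weak_star_continuous_eval R (dual A) (fun G => arens F G f).
  - by move=> k G1 G2 /=; rewrite bidual_actPl linearP.
  - exact: (proj1 (weak_star_continuousP _) Fc f).
  rewrite hP; congr (G _); apply: dualP => a /=.
  have /= := hP (Dual (eval_subproof a)) => <-; congr (F _).
  exact: dualP.
apply/asboolP/weak_star_continuousP => f.
rewrite (_ : (fun G => _) = (fun G : dual (dual A) => G (ract F f))).
  exact: weak_star_eval_continuous.
by apply/funext => G; rewrite FP.
Qed.

End arens.

Arguments center_pred {R} A.

Section topological_center.
Variables (R : realType) (A : banachAlgType R[i]).
Implicit Types (F G : dual (dual A)).

(* The topological center with the first Arens product and the norm of the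
   bidual. *)
Record topological_center := TopologicalCenter {
  center_val :> dual (dual A) ; _ : center_val \in center_pred A }.

HB.instance Definition _ := [isSub for center_val].
HB.instance Definition _ := [Choice of topological_center by <:].

Lemma center_pred_submod : submod_closed (center_pred A).
Proof.
split.
  apply/center_predP => f G.
  by rewrite (_ : Dual _ = 0) ?linear0//; exact: dualP.
move=> k F G /center_predP FP /center_predP GP; apply/center_predP => f H.
rewrite arensPl dualD dualZ FP GP -[k * _]/(k *: (_ : R[i]^o)) -linearP.
by congr (H _); exact: dualP.
Qed.

HB.instance Definition _ := GRing.isSubmodClosed.Build R[i] (dual (dual A))
  (center_pred A) center_pred_submod.
HB.instance Definition _ := [SubChoice_isSubLmodule of topological_center by <:].

Implicit Types u v w : topological_center.

Lemma center_normD u v :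
  `|center_val (u + v)| <= `|center_val u| + `|center_val v|.
Proof. exact: ler_normD. Qed.

Lemma center_normZ (k : R[i]) u :
  `|center_val (k *: u)| = `|k| * `|center_val u|.
Proof. exact: normrZ. Qed.

Lemma center_norm_eq0 u : `|center_val u| = 0 -> u = 0.
Proof. by move=> /normr0_eq0 u0; apply/val_inj. Qed.

HB.instance Definition _ := @Lmodule_isNormed.Build R[i] topological_center
  (fun u => `|center_val u|) center_normD center_normZ center_norm_eq0.

Lemma center_normE u : `|u| = `|center_val u|. Proof. by []. Qed.

Lemma center_closed F :
  (forall e : R[i], 0 < e -> exists2 G, G \in center_pred A & `|F - G| < e) ->
  F \in center_pred A.
Proof.
move=> FG; apply/center_predP => f H; apply/eqP.
rewrite -subr_eq0 -normr_le0; apply/ler_addgt0Pr => e e0; rewrite add0r.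
have c0 : 0 < 1 + (`|H| * `|f| + `|H| * `|f|).
  by rewrite (lt_le_trans ltr01)// lerDl addr_ge0// mulr_ge0.
have [G /center_predP GP FGe] := FG _ (divr_gt0 e0 c0).
set h := Dual _; set g := Dual (bidual_lact_subproof G f).
have hg : `|h - g| <= `|F - G| * `|f|.
  have -> : h - g = Dual (bidual_lact_subproof (F - G) f) by exact: dualP.
  apply: dual_norm_le => [|a]; first by rewrite mulr_ge0.
  rewrite -mulrA.
  apply: le_trans (dual_norm_ub (F - G) (dual_lact a f)) _.
  rewrite ler_wpM2l//.
  exact: norm_dual_lact.
have -> : arens F H f - H h = (F - G) (bidual_act H f) - H (h - g).
  have Gg : G (bidual_act H f) = H g by exact: GP.
  rewrite (linearB H) dualB Gg opprB addrA.
  by rewrite subrK.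
rewrite (le_trans (ler_normB _ _))//.
apply: (@le_trans _ _ (`|F - G| * (1 + (`|H| * `|f| + `|H| * `|f|)))).
  apply: (@le_trans _ _ (`|F - G| * (`|H| * `|f| + `|H| * `|f|))); last first.
    by rewrite ler_wpM2l// lerDr.
  rewrite mulrDr lerD//.
    by rewrite (le_trans (dual_norm_ub _ _))// ler_wpM2l// norm_bidual_act.
  by rewrite (le_trans (dual_norm_ub _ _))// mulrCA ler_wpM2l.
by rewrite -ler_pdivlMr// ltW.
Qed.

Lemma center_cauchy_cvg (F : set_system topological_center) :
  ProperFilter F -> cauchy F -> cvg F.
Proof.
move=> FF /cauchyP Fc.
have : cvg (center_val @ F).
  apply: cauchy_cvg; apply/cauchyP => e e0.
  have [u Fu] := Fc _ e0; exists (center_val u).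
  change (F [set v | ball (center_val u) e (center_val v)]).
  by apply: filterS Fu => v; rewrite -!ball_normE.
move=> /cvg_ex[G /= FG].
have GZ : G \in center_pred A.
  apply: center_closed => e e0.
  have /cvgrPdist_lt/(_ _ e0) FGe := FG.
  have [u /= ue] := filter_ex FGe.
  by exists (center_val u) => //; case: u {ue}.
apply/cvg_ex; exists (TopologicalCenter GZ); apply/cvgrPdist_lt => e e0.
by have /cvgrPdist_lt/(_ _ e0) := FG.
Qed.

HB.instance Definition _ :=
  Uniform_isComplete.Build topological_center center_cauchy_cvg.

Lemma center_arens F G : F \in center_pred A -> G \in center_pred A ->
  arens F G \in center_pred A.
Proof.
move=> /asboolP Fc /asboolP Gc; apply/asboolP => H.
have -> : arens (arens F G) = arens F \o arens G.
  by apply/funext => K; rewrite /= arensA.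
exact: (@continuous_comp (weak_star_space (dual A)) (weak_star_space (dual A))
  (weak_star_space (dual A)) (arens G) (arens F) H (Gc H) (Fc _)).
Qed.

Definition center_mul u v : topological_center :=
  TopologicalCenter (center_arens (valP u) (valP v)).

Lemma center_mulA : associative center_mul.
Proof. by move=> u v w; apply/val_inj; exact: arensA. Qed.

Lemma center_mulPl (k : R[i]) u v w :
  center_mul (k *: u + v) w = k *: center_mul u w + center_mul v w.
Proof. by apply/val_inj; exact: arensPl. Qed.

Lemma center_mulPr (k : R[i]) u v w :
  center_mul u (k *: v + w) = k *: center_mul u v + center_mul u w.
Proof. by apply/val_inj; exact: arensPr. Qed.

Lemma center_normM u v : `|center_mul u v| <= `|u| * `|v|.
Proof. exact: norm_arens. Qed.

HB.instance Definition _ := isBanachAlgebra.Build R[i] topological_center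
  center_mulA center_mulPl center_mulPr center_normM.

End topological_center.

Arguments topological_center {R} A.

Section cyclic_amenability.
Variables (R : realType) (A : banachAlgType R[i]).

Record derivation (D : A -> dual A) : Prop := Derivation {
  derivation_linear : linear D ;
  derivation_continuous : continuous D ;
  derivationM : forall a b : A,
    D (amul a b) = dual_ract (D a) b + dual_lact a (D b) }.

Definition cyclic_derivation (D : A -> dual A) : Prop :=
  derivation D /\ forall a b : A, D a b + D b a = 0.

(* A net is a function on a nonempty directed preorder; it converges when its
   filter of tails does. *)
Definition directed (I : Type) (le : I -> I -> Prop) : Prop :=
  [/\ inhabited I, (forall i, le i i),
      (forall i j k, le i j -> le j k -> le i k) &
      forall i j, exists k, le i k /\ le j k].

Definition tails (I : Type) (le : I -> I -> Prop) : set_system I :=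
  filter_from [set: I] (fun i => [set j | le i j]).

Definition approximately_inner (D : A -> dual A) : Prop :=
  exists (I : Type) (le : I -> I -> Prop) (x : I -> dual A),
    directed le /\
    forall a : A,
      (fun i => dual_lact a (x i) - dual_ract (x i) a) @ tails le --> D a.

Definition approximately_cyclic_amenable : Prop :=
  forall D : A -> dual A, cyclic_derivation D -> approximately_inner D.

End cyclic_amenability.

Arguments approximately_cyclic_amenable {R} A.

(* precompact means that the closure, here for the weak topology of F, is
   compact. *)
Definition weakly_compact (R : realType) (E F : normedModType R[i])
    (T : E -> F) : Prop :=
  precompact (T @` unit_ball E : set (weak_space F)).

(* Main.v *)
Require Import Defs.
From HB Require Import structures.
From mathcomp Require Import all_boot all_order all_algebra.
From mathcomp Require Import all_classical all_reals all_analysis.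
From mathcomp Require Import complex ring lra.

(** Let Z be the topological center, D a cyclic derivation of A, and
D^t : A** -> A*, F |-> F o D, its transpose. The skew-symmetry of the form
(a, b) |-> <D a, b> says that D^t extends -D, hence -D^t is the natural
candidate for an extension of D to A**: put <E u, v> = - <v, D^t u> for u and v
in Z. The theorem follows once E is known to be a cyclic derivation of Z: if E
is the limit of the inner derivations given by a net x_i in Z*, then D is the
limit of those given by the restrictions of the x_i to A, because A embeds in Z
as a subalgebra and E restricts to D (center_extension_restrict).

Cyclicity of E says that <F, D^t G> = - <G, D^t F> (transpose_skew). When F and
G are in A this is the cyclicity of D; in general the left-hand side is
weak-* continuous in F but a priori not in G, and the symmetry of the two
iterated limits is what weak compactness provides: D** maps A** into A*
(bitranspose_weakly_compact, the useful half of Gantmacher's theorem). This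
rests on Goldstine's theorem (goldstine): the unit ball is weak-* dense in the
unit ball of the bidual.

The Leibniz rule for E unfolds, thanks to the defining property of Z, to the
formula of transpose_arens for D^t (F [] G), which follows from the Leibniz
rule of D and a single use of transpose_skew. *)

Set Implicit Arguments.
Unset Strict Implicit.
Unset Printing Implicit Defensive.

Import Order.TTheory GRing.Theory Num.Theory.
Import numFieldNormedType.Exports.

Local Open Scope classical_set_scope.
Local Open Scope ring_scope.
Local Open Scope complex_scope.

(** * Goldstine's theorem *)

Section goldstine.
Variables (R : realType) (E : normedModType R[i]).
Implicit Types (z w : R[i]) (f g h : dual E) (x k q : E) (s : seq (dual E)).

(** The Euclidean inner product of the real plane underlying the complex
numbers. *)
Definition cdot z w : R :=
  complex.Re z * complex.Re w + complex.Im z * complex.Im w.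

Lemma cdot_norm z : cdot z z = complex.Re `|z| ^+ 2.
Proof.
by rewrite normc_def /= sqr_sqrtr ?addr_ge0 ?sqr_ge0// /cdot -!expr2.
Qed.

Lemma cdot_sub_scale z w (t : R) :
  cdot (z - t%:C * w) (z - t%:C * w)
  = cdot z z - t * (2 * cdot z w) + t ^+ 2 * cdot w w.
Proof. by case: z w => [a b] [c d]; rewrite /cdot/=; ring. Qed.

Lemma cdotE z w : cdot z w = complex.Re (z^*%C * w).
Proof. by case: z w => [a b] [c d]; rewrite /cdot/=; ring. Qed.

Lemma dual_sumE (I : Type) (r : seq I) (P : pred I) (F : I -> dual E) x :
  (\sum_(i <- r | P i) F i) x = \sum_(i <- r | P i) F i x.
Proof. exact: (big_morph (fun f : dual E => f x)). Qed.

(** The unit ball is stable under multiplication by complex numbers of modulus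
1, so that the supremum of |h| is also that of its real part. *)
Lemma opnorm_le_Re h (M : R) :
  (forall x, unit_ball E x -> complex.Re (h x) <= M) -> opnorm h <= M.
Proof.
move=> hM; apply: ge_sup; first by have [] := opnorm_has_sup h.
move=> _ [x x1 <-].
have [hx0|hx0] := eqVneq (h x) 0.
  by have := hM x x1; rewrite hx0 normr0.
have b1 : unit_ball E ((`|h x| / h x) *: x).
  by rewrite /unit_ball/= normrZ normrM normfV normr_id divff ?mul1r ?normr_eq0.
by have := hM _ b1; rewrite linearZ/= -[_ *: _]/(_ * _) divfK.
Qed.

Lemma sum_cdot_bounded s : exists2 M : R, 0 <= M &
  forall x q, unit_ball E x -> unit_ball E q ->
    \sum_(g <- s) cdot (g (x - q)) (g (x - q)) <= M.
Proof.
exists (\sum_(g <- s) (2 * opnorm g) ^+ 2).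
  by apply: sumr_ge0 => g _; rewrite sqr_ge0.
move=> x q x1 q1; apply: ler_sum => g _.
rewrite cdot_norm ler_sqr ?nnegrE ?mulr_ge0 ?opnorm_ge0//; last first.
  by rewrite -ler0c normRe.
rewrite -lecR normRe (le_trans (dual_norm_ub _ _))// dual_normE mulrC rmorphM/=.
rewrite ler_wpM2r ?ler0c ?opnorm_ge0// (le_trans (ler_normB _ _))//.
by rewrite rmorphMn/= rmorph1 mulr2n lerD.
Qed.

(** Evaluation at the functionals of s maps the unit ball to a convex set K in
a finite power of the complex plane, and F gives a point P there. If P were at a
positive distance from K, the direction from an almost nearest point of K to P
would define a linear combination h of s whose real part is on the unit ball
smaller, by a fixed amount, than Re (F h); then |F h| > |h|, against
|F| <= 1. *)
Lemma goldstine (F : dual (dual E)) s (e : R[i]) : `|F| <= 1 -> 0 < e ->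
  exists2 x, unit_ball E x & forall g, g \in s -> `|F g - g x| < e.
Proof.
move=> F1 e0.
pose p x g := F g - g x.
(* The squared distance from P to the point of K given by x. *)
pose Q x : R := \sum_(g <- s) cdot (p x g) (p x g).
have cge0 z : 0 <= cdot z z by rewrite cdot_norm sqr_ge0.
pose S := [set Q x | x in unit_ball E].
have b0 : unit_ball E (0 : E) by rewrite /unit_ball/= normr0.
have Slb : lbound S 0 by move=> _ [x _ <-]; exact: sumr_ge0.
have Sinf : has_inf S by split; [exists (Q 0), 0 | exists 0].
have d_le x : unit_ball E x -> inf S <= Q x.
  by move=> x1; apply: ge_inf; [exists 0 | exists x].
have eE : (complex.Re e)%:C = e by rewrite ge0RRe ?ltW.
have re0 : 0 < complex.Re e by rewrite -(ltcR 0) eE.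
suff d0 : inf S <= 0.
  have [_ [x x1 <-]] := inf_adherent (exprn_gt0 2 re0) Sinf => Qx.
  exists x => // g gs; rewrite -normRe -eE ltcR.
  rewrite -(@ltr_pXn2r _ 2) ?nnegrE ?(ltW re0)// -?ler0c ?normRe//.
  rewrite -cdot_norm -/(p x g); apply: (le_lt_trans (y := Q x)); last first.
    by rewrite (lt_le_trans Qx)// gerDr.
  rewrite /Q (big_rem _ gs)/= lerDl; exact: sumr_ge0.
rewrite leNgt; apply/negP; set d := inf S => d0.
have [M M0 MP] := sum_cdot_bounded s.
(* A step t from q towards a point of K changes the squared distance by a first
   order term and by at most t^2 M; this t makes t^2 M at most t d / 2. *)
pose t := d / (2 * (M + d)).
have Md : 0 < M + d by rewrite ltr_wpDl.
have t0 : 0 < t by rewrite divr_gt0// mulr_gt0.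
have t1 : t <= 1 by rewrite ler_pdivrMr ?mulr_gt0//; lra.
have tM : t * M <= d / 2.
  by rewrite /t mulrAC ler_pdivrMr ?mulr_gt0//; nra.
have td : 0 < t * (d / 2) by rewrite mulr_gt0// divr_gt0.
have [_ [q q1 <-]] := inf_adherent td Sinf => Qq.
pose h : dual E := \sum_(g <- s) (p q g)^*%C *: g.
have hE x : complex.Re (h x) = \sum_(g <- s) cdot (p q g) (g x).
  by rewrite dual_sumE raddf_sum/=; apply: eq_bigr => g _; rewrite cdotE.
have FhE : complex.Re (F h) = complex.Re (h q) + Q q.
  rewrite hE linear_sum/= raddf_sum/= -big_split/=; apply: eq_bigr => g _.
  rewrite linearZ/= -[_ *: _]/(_ * _) -cdotE /p.
  by case: (F g) (g q) => [a b] [c c']; rewrite /cdot/=; ring.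
(* First variation: q is nearest up to t * d / 2, so moving from q by t (k - q)
   lowers the squared distance by at most that much. *)
have hk k : unit_ball E k -> complex.Re (h k) <= complex.Re (h q) + d / 2.
  move=> k1.
  have bk : unit_ball E (q + t%:C *: (k - q)).
    have -> : q + t%:C *: (k - q) = (1 - t)%:C *: q + t%:C *: k.
      by rewrite rmorphB rmorph1 scalerBl scale1r scalerBr addrA addrAC.
    rewrite /unit_ball/= (le_trans (ler_normD _ _))// !normrZ.
    rewrite !ger0_norm ?ler0c ?subr_ge0 ?(ltW t0)//.
    apply: (@le_trans _ _ ((1 - t)%:C + t%:C)).
      by rewrite lerD// -[leRHS]mulr1 ler_wpM2l// ler0c ?subr_ge0// ltW.
    by rewrite -rmorphD/= subrK.
  have := d_le _ bk.
  have -> : Q (q + t%:C *: (k - q)) = Q q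
      - t * (2 * complex.Re (h (k - q)))
      + t ^+ 2 * \sum_(g <- s) cdot (g (k - q)) (g (k - q)).
    rewrite hE !mulr_sumr -sumrB -big_split/=; apply: eq_bigr => g _.
    rewrite -cdot_sub_scale /p linearD linearZ/= -[_ *: _]/(_ * _).
    by rewrite opprD addrA.
  have := MP _ _ k1 q1; rewrite linearB raddfB/=.
  set m := \sum_(g <- s) _; set a := complex.Re (h k).
  set b := complex.Re (h q) => mM.
  rewrite -/d in Qq *; move=> dQ.
  have tm : t * m <= d / 2 by apply: le_trans tM; rewrite ler_pM2l.
  have : t * (2 * (a - b)) < t * (d / 2 + t * m).
    by rewrite mulrDr; nra.
  by rewrite ltr_pM2l//; lra.
have : complex.Re (F h) <= complex.Re (h q) + d / 2.
  apply: le_trans (opnorm_le_Re hk); rewrite -lecR.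
  apply: (@le_trans _ _ `|F h|).
    by rewrite (le_trans _ (normRe_le _))// lecR ler_norm.
  rewrite (le_trans (dual_norm_ub _ _))// dual_normE -[leRHS]mul1r.
  by rewrite ler_wpM2r// ler0c opnorm_ge0.
by rewrite FhE; have := d_le _ q1; rewrite -/d; lra.
Qed.

End goldstine.

(** * Transposes and Gantmacher's theorem *)

Section bounded_maps.
Variables (R : realType) (E F : normedModType R[i]) (T : E -> F).
Hypothesis linT : linear T.

Lemma bounded_continuous (M : R[i]) :
  0 <= M -> (forall x, `|T x| <= M * `|x|) -> continuous T.
Proof.
move=> M0 TM.
pose L : {linear E -> F} :=
  HB.pack (T : E -> F) (GRing.isLinear.Build _ _ _ _ T linT).
apply: (@bounded_linear_continuous _ _ _ L).
apply/bounded_funP => r; exists (M * r) => x xr.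
by rewrite (le_trans (TM x))// ler_wpM2l.
Qed.

Lemma continuous_bounded : continuous T ->
  exists2 M : R[i], 0 <= M & forall x, `|T x| <= M * `|x|.
Proof.
move=> cT.
pose L : {linear E -> F} :=
  HB.pack (T : E -> F) (GRing.isLinear.Build _ _ _ _ T linT).
have /linear_boundedP/pinfty_ex_gt0[M M0 TM] : bounded_near L (nbhs (0 : E)).
  exact/linear_bounded_continuous.
by exists M => //; exact: ltW.
Qed.

End bounded_maps.

Section gantmacher.
Variables (R : realType) (E F : normedModType R[i]) (T : E -> F).
Hypotheses (linT : linear T) (contT : continuous T).

Lemma transpose_subproof (g : dual F) :
  (fun x => g (T x) : R[i]^o) \in dual_pred E.
Proof.
apply/asboolP; split=> [k x y|x]; first by rewrite linT linearP.
by apply: (@continuous_comp _ _ _ T g); [exact: contT | exact: dual_continuous].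
Qed.

Definition transpose (g : dual F) : dual E := Dual (transpose_subproof g).

Lemma transposeP k g h :
  transpose (k *: g + h) = k *: transpose g + transpose h.
Proof. exact: dualP. Qed.

Lemma weak_nbhs (y : F) (g : dual F) (e : R[i]) : 0 < e ->
  nbhs (y : weak_space F) [set z : F | `|g y - g z| < e].
Proof.
move=> e0.
have gc : {for (y : weak_space F), continuous (g : weak_space F -> R[i]^o)}.
  apply: (@continuous_comp (weak_space F) {ptws dual F -> R[i]^o} R[i]^o
    (fun x : F => (fun f : dual F => f x)) (fun u => u g)).
    exact: (@initial_continuous _ {ptws dual F -> R[i]^o}
      (fun x : F => (fun f : dual F => f x))).
  exact: (@proj_continuous _ (fun=> R[i]^o) g).
exact: (proj1 (cvgrPdist_lt _ _) gc e e0).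
Qed.

(** By Goldstine's theorem a functional Phi of norm at most 1 is the weak-*
limit of a filter on the unit ball of E. The image of this filter under T has a
weak cluster point y by weak compactness, and on every g the values of g along
that image converge to Phi (g o T), hence g y = Phi (g o T). *)
Lemma bitranspose_weakly_compact (Phi : dual (dual E)) : weakly_compact T ->
  exists y : F, forall g : dual F, Phi (transpose g) = g y.
Proof.
rewrite /weakly_compact precompactE => Tc.
wlog P1 : Phi / `|Phi| <= 1 => [main|].
  have [->|P0] := eqVneq Phi 0.
    by exists 0 => g; rewrite dual0 linear0.
  have [|y yP] := main (`|Phi|^-1 *: Phi).
    by rewrite normrZ normfV normr_id mulVf// normr_eq0.
  exists (`|Phi| *: y) => g; rewrite linearZ/= -yP dualZ -[_ *: _]/(_ * _).
  by rewrite mulVKf// normr_eq0.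
(* The image under T of the trace on the unit ball of a basic weak-*
   neighbourhood of Phi. *)
pose B (i : seq (dual E) * R) : set (weak_space F) :=
  [set T x | x in [set x | unit_ball E x /\
    forall g, g \in i.1 -> `|Phi g - g x| < i.2%:C]].
pose N := filter_from [set i | 0 < i.2] B.
have NF : ProperFilter N.
  apply: filter_from_proper => [|[s e]/= e0]; last first.
    have e0' : 0 < e%:C by rewrite ltcR.
    by have [x x1 xs] := goldstine s P1 e0'; exists (T x), x.
  apply: filter_from_filter; first by exists ([::], 1); exact: ltr01.
  move=> [s e] [t d]/= e0 d0; exists (s ++ t, Order.min e d); rewrite /=.
    by rewrite lt_min e0 d0.
  move=> _ [x [x1 xst] <-]; split; exists x => //; split=> // g gs.
  - by apply: lt_le_trans (xst g _) _; rewrite ?mem_cat ?gs// lecR ge_min lexx.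
  - apply: lt_le_trans (xst g _) _; first by rewrite mem_cat gs orbT.
    by rewrite lecR ge_min lexx orbT.
have [|y [_ yN]] := Tc N NF.
  exists ([::], 1); first exact: ltr01.
  by move=> _ [x [x1 _] <-]; apply: subset_closure; exists x.
exists y => g; apply/eqP; rewrite -subr_eq0 -normr_le0.
apply/ler_addgt0Pr => e e0; rewrite add0r.
have e2 : 0 < e / 2 by rewrite divr_gt0.
have e2E : (complex.Re (e / 2))%:C = e / 2 by rewrite ge0RRe ?ltW.
have NB : N (B ([:: transpose g], complex.Re (e / 2))).
  exists ([:: transpose g], complex.Re (e / 2)) => //=.
  by rewrite -(ltcR 0) e2E.
have [_ [[x [x1 xg] <-] xy]] := yN _ _ NB (weak_nbhs y g e2).
rewrite (splitr e) (le_trans (ler_distD (g (T x)) _ _))// lerD//; last first.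
  by rewrite distrC ltW.
by apply: ltW; rewrite -e2E; exact: (xg (transpose g) (mem_head _ _)).
Qed.

End gantmacher.

Lemma transpose_continuous (R : realType) (E F : normedModType R[i])
    (T : E -> F) (linT : linear T) (contT : continuous T) :
  continuous (transpose linT contT).
Proof.
have [M M0 TM] := continuous_bounded linT contT.
apply: (bounded_continuous (@transposeP _ _ _ _ linT contT) M0) => g.
apply: dual_norm_le => [|x]; first by rewrite mulr_ge0.
rewrite (le_trans (dual_norm_ub g (T x)))// [M * _]mulrC -mulrA.
by rewrite ler_wpM2l.
Qed.

(** * The embedding of an algebra into the topological center *)

Section canonical_embedding.
Variables (R : realType) (A : banachAlgType R[i]).

Definition canon (a : A) : dual (dual A) := Dual (eval_subproof a).

Lemma canon_center a : canon a \in center_pred A.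
Proof. by apply/center_predP => f G /=; congr (G _); exact: dualP. Qed.

Definition to_center a : topological_center A :=
  TopologicalCenter (canon_center a).

Lemma to_center_linear : linear to_center.
Proof. by move=> k a b; apply/val_inj/dualP => f; exact: linearP. Qed.

Lemma to_center_continuous : continuous to_center.
Proof.
apply: (bounded_continuous to_center_linear (@ler01 _)) => a.
rewrite mul1r center_normE; apply: dual_norm_le => // f.
by rewrite mulrC; exact: dual_norm_ub.
Qed.

Lemma to_centerM a b : to_center (amul a b) = amul (to_center a) (to_center b).
Proof. by apply/val_inj/dualP. Qed.

End canonical_embedding.

(** * Extension of a cyclic derivation to the topological center *)

Section extension.
Variables (R : realType) (A : banachAlgType R[i]) (D : A -> dual A).
Hypotheses (cycD : cyclic_derivation D) (wcD : weakly_compact D).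

Let linD : linear D. Proof. by case: cycD => -[]. Qed.
Let contD : continuous D. Proof. by case: cycD => -[]. Qed.
Let DM a b : D (amul a b) = dual_ract (D a) b + dual_lact a (D b).
Proof. by case: cycD => -[]. Qed.
Let Dskew a b : D a b = - D b a.
Proof. by case: cycD => _ H; apply/eqP; rewrite -addr_eq0 H. Qed.

Let Dt := transpose linD contD.

(** Weak compactness represents G |-> F (Dt G) by some y in A*. Taking for G
the elements of A identifies y, through the cyclicity of D, as - Dt F. *)
Lemma transpose_skew (F G : dual (dual A)) : F (Dt G) = - G (Dt F).
Proof.
have [y yP] := bitranspose_weakly_compact linD contD F wcD.
rewrite yP -linearN/=; congr (G _); apply: dualP => a.
rewrite -[y a]/(canon a y) -yP -[(- Dt F) a]/(- F (D a)) -linearN/=.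
by congr (F _); apply: dualP => b; rewrite /= Dskew.
Qed.

Lemma center_extension_subproof (F : dual (dual A)) :
  (fun v : topological_center A => - center_val v (Dt F) : R[i]^o)
    \in dual_pred (topological_center A).
Proof.
apply: (@bounded_dual _ _ _ `|Dt F|) => [k u v|v].
  by rewrite dualD dualZ opprD -mulrN.
by rewrite normrN mulrC; exact: dual_norm_ub.
Qed.

(** By transpose_skew this is the restriction of D** u to the center. The
formula through Dt makes it visibly weak-* continuous in v. *)
Definition center_extension (u : topological_center A) :
  dual (topological_center A) := Dual (center_extension_subproof u).

(** Evaluated at c, the left-hand side is F (G . D c) and the summands on the
right are G (c . Dt F) and F (Dt G . c). The Leibniz rule for D (c b) turns the
second one into F (G . D c) + F (Dt (G [] c)), and by skew-symmetry
F (Dt (G [] c)) = - G (c . Dt F). The first summand is spelled as the functional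
for which membership of G in the center gives its value at every H in A** as
(G [] H) (Dt F). *)
Lemma transpose_arens (F G : dual (dual A)) :
  Dt (arens F G) =
  Dual (bidual_lact_subproof G (Dt F)) + bidual_act F (Dt G).
Proof.
apply: dualP => c.
have dG : dual_ract (Dt G) c = bidual_act G (D c) + Dt (arens G (canon c)).
  apply: dualP => b /=; rewrite DM linearD; congr (_ + G _).
  exact: dualP.
rewrite dualD /= dG linearD/= transpose_skew addrCA.
rewrite (_ : G (dual_lact c _) = arens G (canon c) (Dt F)) ?subrr ?addr0//=.
by congr (G _); exact: dualP.
Qed.

Lemma center_extension_cyclic : cyclic_derivation center_extension.
Proof.
have linE : linear center_extension.
  move=> k u v; apply: dualP => w /=.
  rewrite [Dt _](_ : _ = k *: Dt u + Dt v); last exact: dualP.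
  by rewrite linearP opprD/= -mulrN.
split; last by move=> u v /=; rewrite transpose_skew opprK subrr.
split=> // [|u v].
  have [M M0 DtM] := continuous_bounded (@transposeP _ _ _ _ linD contD)
    (@transpose_continuous _ _ _ _ linD contD).
  apply: (bounded_continuous linE M0) => u.
  apply: dual_norm_le => [|v /=]; first by rewrite mulr_ge0.
  rewrite normrN (le_trans (dual_norm_ub _ _))// mulrC ler_wpM2r//.
  exact: DtM.
(* Leibniz rule: v is in the center, so its first and second Arens products
   with w agree. *)
apply: dualP => w; rewrite dualD /= transpose_arens linearD/= opprD.
by rewrite -(center_predP _ (valP v)).
Qed.

Lemma center_extension_restrict a :
  transpose (@to_center_linear _ A) (@to_center_continuous _ A)
    (center_extension (to_center a)) = D a.
Proof. by apply: dualP => b; rewrite [RHS]Dskew. Qed.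

End extension.

(** * Transfer of approximate cyclic amenability *)

Theorem theorem3p6 (R : realType) (A : banachAlgType R[i])
    (weakly_compactA : forall D : A -> dual A,
       cyclic_derivation D -> weakly_compact D) :
  approximately_cyclic_amenable (topological_center A) ->
  approximately_cyclic_amenable A.
Proof.
move=> amZ D cycD.
have [I [le [x [dir_le xP]]]] :=
  amZ _ (center_extension_cyclic cycD (weakly_compactA _ cycD)).
pose restr := transpose (@to_center_linear _ A) (@to_center_continuous _ A).
exists I, le, (restr \o x); split=> // a.
rewrite -(center_extension_restrict cycD a) -/restr.
have -> : (fun i => dual_lact a ((restr \o x) i) - dual_ract ((restr \o x) i) a)
    = restr \o (fun i => dual_lact (to_center a) (x i)
                         - dual_ract (x i) (to_center a)).
  by apply/funext => i; apply: dualP => b; rewrite dualB /= !to_centerM.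
by apply: cvg_comp (xP _) _; exact: transpose_continuous.
Qed.
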